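(* Let $M$ be a compact Riemannian manifold without boundary, let $X$ be a $C^1$ vector field on $M$ generating the flow $\varphi_t$, and let $\Lambda\subset M$ be a compact $\varphi_t$-invariant set such that $\varphi_t|_{\Lambda}$ is rescaling separating. If every singularity of $X$ in $\Lambda$ is hyperbolic, then for any $Y\in\mathcal{Z}^1(\varphi_t|_{\Lambda})$ there is a continuous map $A:\Lambda\setminus\mathrm{Sing}(X)\to\mathbb{R}$ which is constant along orbits of $\varphi_t$ such that $\psi_t(x)=\varphi_{A(x)t}(x)$ for all $x\in\Lambda\setminus\mathrm{Sing}(X)$ and all $t\in\mathbb{R}$, where $\psi_t$ is the flow generated by $Y$.
   Context: $\mathcal{X}^r(M)$ denotes the set of $C^r$ vector fields on $M$ ($r\ge 1$), $d$ is the Riemannian distance, $\mathrm{Sing}(X)=\{x\in M: X(x)=0\}$, and $\mathrm{Orb}(x)=\{\varphi_t(x):t\in\mathbb{R}\}$. Rescaling separating: $\varphi_t|_\Lambda$ is rescaling separating if there is $\varepsilon>0$ such that for any $x,y\in\Lambda$, if $d(\varphi_t(x),\varphi_t(y))\le\varepsilon\|X(\varphi_t(x))\|$ for all $t\in\mathbb{R}$, then $y\in\mathrm{Orb}(x)$. Centralizer: $\mathcal{Z}^r(\varphi_t|_{\Lambda})$ is the set of $Y\in\mathcal{X}^r(M)$ whose generated flow $\psi_t$ satisfies $\psi_t(\Lambda)=\Lambda$ and $\psi_s\circ\varphi_t|_\Lambda=\varphi_t\circ\psi_s|_\Lambda$ for all $t,s\in\mathbb{R}$. *)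

(* Defs.v *)
From HB Require Import structures.
From mathcomp Require Import all_boot all_order all_algebra.
From mathcomp Require Import all_classical all_reals all_analysis.
From mathcomp Require Import complex.

Set Implicit Arguments.
Unset Strict Implicit.
Unset Printing Implicit Defensive.

Import Order.TTheory GRing.Theory Num.Theory.
Import numFieldNormedType.Exports.

Local Open Scope classical_set_scope.
Local Open Scope ring_scope.

(* f is C^k on U; meant for V finite-dimensional and U open, where continuity
   of all directional derivatives is continuity of the differential. *)
Fixpoint Ck (R : realType) (V W : normedModType R) (k : nat) (f : V -> W)
    (U : set V) : Prop :=
  if k is k'.+1 then
    (forall x, U x -> differentiable f x) /\
    (forall v : V, Ck k' (fun x => 'D_v f x) U)
  else forall x, U x -> {for x, continuous f}.

Definition smooth (R : realType) (V W : normedModType R) (f : V -> W)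
    (U : set V) : Prop := forall k, Ck k f U.

(* C^oo manifolds of dimension n without boundary. [chart i] and [unchart i] are
   total functions, meaningful on [dom i] and on its image, respectively.
   A preferred chart [chart_at p] is chosen around every point p, and a tangent
   vector at p is represented by its coordinates in that chart, so that T_pM is
   'rV[R]_n for every p. *)
Record manifold (R : realType) (n : nat) : Type := Manifold {
  carrier :> topologicalType;
  index : Type;
  dom : index -> set carrier;
  chart : index -> carrier -> 'rV[R]_n;
  unchart : index -> 'rV[R]_n -> carrier;
  chart_at : carrier -> index;
  manifold_hausdorff : hausdorff_space carrier;
  manifold_second_countable : @second_countable carrier;
  dom_open : forall i, open (dom i);
  chart_image_open : forall i, open (chart i @` dom i);
  chartK : forall i p, dom i p -> unchart i (chart i p) = p;
  chart_continuous : forall i p, dom i p -> {for p, continuous (chart i)};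
  unchart_continuous : forall i z, (chart i @` dom i) z ->
    {for z, continuous (unchart i)};
  transition_smooth : forall i j,
    smooth (chart j \o unchart i) (chart i @` (dom i `&` dom j));
  dom_chart_at : forall p, dom (chart_at p) p
}.

Section Tangent.
Variables (R : realType) (n : nat) (M : manifold R n).
Implicit Types (p : M) (i : index M) (v : 'rV[R]_n).

(* Coordinates in chart i of the tangent vector v at p. *)
Definition to_chart i p v : 'rV[R]_n :=
  'd (chart i \o unchart (chart_at p)) (chart (chart_at p) p) v.

(* The tangent vector at p whose coordinates in chart i are v. *)
Definition of_chart i p v : 'rV[R]_n :=
  'd (chart (chart_at p) \o unchart i) (chart i p) v.

Definition vector_field : Type := M -> 'rV[R]_n.

Definition local_field (X : vector_field) i (z : 'rV[R]_n) : 'rV[R]_n :=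
  to_chart i (unchart i z) (X (unchart i z)).

Definition Cr_field (r : nat) : set vector_field :=
  [set X | forall i, Ck r (local_field X i) (chart i @` @dom R n M i)].

Definition Sing (X : vector_field) : set M := [set p | X p = 0].

(* At a singularity the conjugacy class of the Jacobian matrix, hence its
   spectrum, does not depend on the chart. *)
Definition hyperbolic (X : vector_field) p : Prop :=
  Sing X p /\
  let DX : 'M[R]_n := jacobian (local_field X (chart_at p))
                               (chart (chart_at p) p) in
  forall l : R[i], eigenvalue (map_mx (fun x : R => (x%:C)%C) DX : 'M[R[i]]_n) l ->
    complex.Re l != 0.

Definition is_flow (phi : R -> M -> M) : Prop :=
  [/\ forall x, phi 0 x = x,
      forall s t x, phi (s + t) x = phi s (phi t x) &
      continuous (fun tx : R * M => phi tx.1 tx.2)].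

Definition generates (X : vector_field) (phi : R -> M -> M) : Prop :=
  is_flow phi /\
  forall (x : M) (t : R),
    is_derive t 1 (chart (chart_at (phi t x)) \o (fun s => phi s x))
      (X (phi t x)).

Definition Orb (phi : R -> M -> M) (x : M) : set M := [set phi t x | t in [set: R]].

Definition invariant_set (phi : R -> M -> M) (L : set M) : Prop :=
  forall t, phi t @` L = L.

(* On a compact M every C^1 field generates exactly one flow, so the choice of
   psi is immaterial. *)
Definition centralizer (r : nat) (phi : R -> M -> M) (L : set M) :
    set vector_field :=
  [set Y | Cr_field r Y /\ exists psi : R -> M -> M,
    [/\ generates Y psi, invariant_set psi L &
        forall t s x, L x -> psi s (phi t x) = phi t (psi s x)]].

Definition C1_curve (gamma : R -> M) : Prop :=
  continuous gamma /\
  forall i t, dom i (gamma t) ->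
    derivable (chart i \o gamma) t 1 /\
    {for t, continuous (derive1 (chart i \o gamma))}.

Definition velocity (gamma : R -> M) (t : R) : 'rV[R]_n :=
  derive1 (chart (chart_at (gamma t)) \o gamma) t.

End Tangent.

(* [metric p] is the Gram matrix of the inner product of T_pM in [chart_at p];
   smoothness is that of the Gram matrix entries in every chart. *)
Record riemannianManifold (R : realType) (n : nat) : Type := RiemannianManifold {
  rmanifold :> manifold R n;
  metric : rmanifold -> 'M[R]_n;
  inner := fun (p : rmanifold) (u v : 'rV[R]_n) => (u *m metric p *m v^T) 0 0;
  metric_sym : forall p u v, inner p u v = inner p v u;
  metric_pos : forall p v, v != 0 -> 0 < inner p v v;
  metric_smooth : forall (i : index rmanifold) (u v : 'rV[R]_n),
    smooth (fun z : 'rV[R]_n => inner (unchart i z)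
        (of_chart i (unchart i z) u) (of_chart i (unchart i z) v))
      (chart i @` dom i)
}.

Section Distance.
Variables (R : realType) (n : nat) (M : riemannianManifold R n).

Definition tnorm (p : M) (v : 'rV[R]_n) : R := Num.sqrt (inner p v v).

Definition arc_length (gamma : R -> M) : \bar R :=
  (\int[lebesgue_measure]_(t in `[0%R, 1%R])
     (tnorm (gamma t) (velocity gamma t))%:E)%E.

(* [pw_length x y l] : some piecewise C^1 curve from x to y has length l. Such a
   curve is a finite concatenation of C^1 curves on [0, 1], each taken to be
   defined and C^1 on the whole line. *)
Inductive pw_length : M -> M -> \bar R -> Prop :=
| pw_nil (x : M) : pw_length x x 0%E
| pw_cons (gamma : R -> M) (y : M) (l : \bar R) :
    C1_curve gamma -> pw_length (gamma 1) y l ->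
    pw_length (gamma 0) y (arc_length gamma + l)%E.

(* +oo between different connected components. *)
Definition rdist (x y : M) : \bar R := ereal_inf [set l | pw_length x y l].

Definition rescaling_separating (X : vector_field M) (phi : R -> M -> M)
    (L : set M) : Prop :=
  exists2 eps : R, 0 < eps &
    forall x y, L x -> L y ->
      (forall t, (rdist (phi t x) (phi t y) <=
                  (eps * tnorm (phi t x) (X (phi t x)))%:E)%E) ->
      Orb phi x y.

End Distance.

(* Main.v *)
Require Import Defs.
From mathcomp Require Import all_boot all_order all_algebra.
From mathcomp Require Import all_classical all_reals all_analysis.
From mathcomp Require Import measurable_realfun complex ring lra.
Import Order.TTheory GRing.Theory Num.Theory.
Import numFieldNormedType.Exports.
Local Open Scope classical_set_scope.
Local Open Scope ring_scope.

(** Why the theorem holds.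

    The flow [psi] commutes with [phi] on [L], so the points [x] and [psi s x]
    have orbits related by [phi t (psi s x) = psi s (phi t x)]. Their distance
    at time [t] is at most the length of the orbit segment of [Y] from
    [z = phi t x] to [psi s z], that is, at most [|s|] times the supremum of
    the norm of [Y] along it ([rdist_flow_le]). Everything therefore rests on a
    constant [d > 0] with [d * |Y (psi u z)| <= |X z|] for all [z] in [L] and
    [|u| <= d]: then small [s] satisfy the hypothesis of the rescaling
    separating property, and [psi s x] lies on the [phi]-orbit of [x], first for
    small [s] and then for all [s] by composition.

    By compactness of [L] the constant is needed only locally. Near a regular
    point [|X|] is bounded below and [|Y|] above ([dominated_near_regular]). Let
    [p] be a singularity of [X] in [L]. Hyperbolicity makes the linear part of
    [X] at [p] invertible, so that in a chart [|X z| >= c |z - p|]. In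
    particular [p] is an isolated singularity; [psi s p] is again a singularity
    because [psi] commutes with [phi], so [psi s p = p] for small [s] and
    [Y p = 0]. As [Y] is Lipschitz, [|Y (psi u z)| <= K |z - p|] for small [u],
    and the two estimates combine ([dominated_near_singular]).

    It remains to see that, for [x] regular, [psi s x = phi (a s) x] with a
    constant [a] ([orbit_reparametrization]). The pairs [(s, t)] with
    [psi s x = phi t x] form a closed subgroup of the plane which projects onto
    the first axis. The real line being uncountable, the subgroup has arbitrarily
    small elements with [s != 0]. For such elements [t / s] tends to
    [a = Y_j x / X_j x] for any coordinate [j] with [X_j x != 0], by
    differentiating both flows at time zero; integer multiples of these elements
    then approach every [(r, a r)], and closedness concludes.

    Differentiating [psi s x = phi (a s) x] gives [Y x = a X x], so that
    [a = <Y x, X x> / <X x, X x>], which depends continuously on the regular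
    point [x]. It is constant along orbits because [phi t] carries the relation
    at [x] to the same relation at [phi t x]. *)

Set Implicit Arguments.
Unset Strict Implicit.
Unset Printing Implicit Defensive.

(** * Curves and maps in coordinate space *)

Section Calculus.
Variables (R : realType) (n : nat).
Implicit Types (a b : R -> 'rV[R]_n) (z v w : 'rV[R]_n) (s t u : R).

Lemma rV_norm_le v c : 0 <= c -> (forall j, `|v 0 j| <= c) -> `|v| <= c.
Proof.
move=> c0 vc; rewrite /Num.norm/= mx_normrE bigmax_le// => -[i j] _ /=.
by rewrite ord1.
Qed.

Lemma rV_coord_le v j : `|v 0 j| <= `|v|.
Proof. by rewrite [leRHS]/Num.norm/= mx_normrE; apply: (le_bigmax _ _ (0, j)). Qed.

Lemma is_derive_coord a t v j : is_derive t 1 a v ->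
  is_derive t 1 (fun s => a s 0 j) (v 0 j).
Proof.
move=> [da <-]; have daj := (derivable_mxP _ _ _).1 da 0 j.
by apply: DeriveDef => //; rewrite derive_mx// mxE.
Qed.

Lemma is_derive_continuous a t v : is_derive t 1 a v -> {for t, continuous a}.
Proof.
by move=> [da _]; apply: differentiable_continuous; apply/derivable1_diffP.
Qed.

(** The mean value theorem fails for vector-valued curves but the inequality
    survives, one coordinate at a time, since the norm is the largest
    coordinate. *)
Lemma mean_value_rV a da (m : R) s t : s <= t -> 0 <= m ->
  (forall u, s <= u <= t -> is_derive u 1 a (da u)) ->
  (forall u, s <= u <= t -> `|da u| <= m) ->
  `|a t - a s| <= m * (t - s).
Proof.
move=> st m0 ada dam; apply: rV_norm_le => [|j].
  by rewrite mulr_ge0// subr_ge0.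
have /MVT_segment : s <= t := st.
move=> /(_ (fun u => a u 0 j) (fun u => da u 0 j)) [||c].
- move=> u; rewrite in_itv/= => /andP[su ut].
  by apply: is_derive_coord; apply: ada; rewrite !ltW.
- apply: derivable_within_continuous => u; rewrite in_itv/= => /ada H.
  by have [] := is_derive_coord j H.
rewrite in_itv/= => /dam dacm; rewrite !mxE => ->.
rewrite normrM [`|t - s|]ger0_norm ?subr_ge0// ler_wpM2r ?subr_ge0//.
exact: le_trans (rV_coord_le _ _) dacm.
Qed.

(** Two solutions of a Lipschitz equation cannot separate by more than a factor
    two during a time [d <= 1 / (2 K)]: at the time where their distance [m] is
    largest, the mean value inequality gives [m <= |a 0 - b 0| + d K m]. *)
Lemma solutions_stay_close (F : 'rV[R]_n -> 'rV[R]_n) (B : set 'rV[R]_n) (K d : R) a b :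
  0 <= d -> d * K <= 1 / 2 -> 0 <= K ->
  (forall v w, B v -> B w -> `|F v - F w| <= K * `|v - w|) ->
  (forall u, `|u| <= d -> B (a u) /\ B (b u)) ->
  (forall u, `|u| <= d -> is_derive u 1 a (F (a u))) ->
  (forall u, `|u| <= d -> is_derive u 1 b (F (b u))) ->
  forall u, `|u| <= d -> `|a u - b u| <= 2 * `|a 0 - b 0|.
Proof.
move=> d0 dK K0 FK aB aF bF.
pose c u := a u - b u.
have cF u : `|u| <= d -> is_derive u 1 c (F (a u) - F (b u)).
  by move=> ud; have H1 := aF _ ud; have H2 := bF _ ud; exact: is_deriveB.
have [||m] := @EVT_max _ (fun u => `|c u|) (- d) d.
- by lra.
- apply: continuous_in_subspaceT => u; rewrite inE/= in_itv/= -ler_norml.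
  by move=> /cF/is_derive_continuous cu; apply: (continuous_comp cu); exact: norm_continuous.
rewrite in_itv/= -ler_norml => md mmax.
have cm u : `|u| <= d -> `|c u| <= `|c m|.
  by move=> ud; apply: mmax; rewrite in_itv/= -ler_norml.
have dcm u : `|u| <= d -> `|F (a u) - F (b u)| <= K * `|c m|.
  move=> ud; have [Ba Bb] := aB _ ud.
  by rewrite (le_trans (FK _ _ Ba Bb))// ler_wpM2l// cm.
have m2 : `|c m - c 0| <= K * `|c m| * d.
  have Kc : 0 <= K * `|c m| by rewrite mulr_ge0.
  have [m0|m0] := leP 0 m.
    rewrite (le_trans (@mean_value_rV c (fun u => F (a u) - F (b u)) _ 0 m m0 Kc _ _))//.
    - by move=> u /andP[? ?]; apply: cF; rewrite ger0_norm// (le_trans _ md)// ger0_norm.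
    - by move=> u /andP[? ?]; apply: dcm; rewrite ger0_norm// (le_trans _ md)// ger0_norm.
    by rewrite subr0 ler_wpM2l// (le_trans _ md)// ger0_norm.
  rewrite distrC.
  rewrite (le_trans (@mean_value_rV c (fun u => F (a u) - F (b u)) _ m 0 (ltW m0) Kc _ _))//.
  - move=> u /andP[? ?]; apply: cF; rewrite ler0_norm// (le_trans _ md)//.
    by rewrite ler0_norm ?lerN2 ?(ltW m0).
  - move=> u /andP[? ?]; apply: dcm; rewrite ler0_norm// (le_trans _ md)//.
    by rewrite ler0_norm ?lerN2 ?(ltW m0).
  by rewrite sub0r ler_wpM2l// (le_trans _ md)// ltr0_norm.
move=> u ud; rewrite (le_trans (cm _ ud))//.
have : `|c m| <= `|c m - c 0| + `|c 0|.
  by rewrite -[X in `|X| <= _](subrK (c 0)); exact: ler_normD.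
have : K * `|c m| * d <= 1 / 2 * `|c m| by rewrite mulrAC ler_wpM2r// mulrC.
rewrite -[a 0 - b 0]/(c 0); lra.
Qed.

Lemma is_derive_comp_diff (W V : normedModType R) (f : V -> W) (g : R -> V) t (w : V) :
  is_derive t 1 g w -> differentiable f (g t) ->
  is_derive t 1 (f \o g) ('d f (g t) w).
Proof.
move=> [/derivable1_diffP dg <-] df; have dfg := differentiable_comp dg df.
apply: DeriveDef; first exact/derivable1_diffP.
by rewrite deriveE// diff_comp//= deriveE.
Qed.

Lemma diff_norm_le (f : 'rV[R]_n -> 'rV[R]_n) z v : differentiable f z ->
  `|'d f z v| <= (\sum_(j < n) `|'D_(delta_mx 0 j) f z|) * `|v|.
Proof.
move=> df; rewrite [in leLHS](row_sum_delta v) linear_sum/=.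
rewrite (le_trans (ler_norm_sum _ _ _))// mulr_suml ler_sum// => j _.
by rewrite linearZ/= normrZ deriveE// mulrC ler_wpM2l// rV_coord_le.
Qed.

(** The partial derivatives are bounded near [z] by continuity, and balls are
    convex, so the mean value inequality applies along segments. *)
Lemma C1_lipschitz (f : 'rV[R]_n -> 'rV[R]_n) (U : set 'rV[R]_n) z :
  Ck 1 f U -> open U -> U z ->
  exists K r, [/\ 0 < K, 0 < r, ball z r `<=` U &
    forall v w, ball z r v -> ball z r w -> `|f v - f w| <= K * `|v - w|].
Proof.
move=> [fd fc] oU Uz.
(* The margin 1 absorbs the variation of each partial derivative over the
   ball. *)
pose K := \sum_(j < n) (`|'D_(delta_mx 0 j) f z| + 1).
have K0 : 0 <= K by apply: sumr_ge0 => j _; rewrite addr_ge0.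
have : \forall y \near z, U y /\ forall j, `|'D_(delta_mx 0 j) f y| <= `|'D_(delta_mx 0 j) f z| + 1.
  near=> y; split; first by near: y; exact: open_nbhs_nbhs.
  near: y; apply: filter_forall => j.
  have /= fcj := fc (delta_mx 0 j) z Uz.
  have /cvgrPdist_le/(_ 1 ltr01) : (fun x => 'D_(delta_mx 0 j) f x) y @[y --> z] --> 'D_(delta_mx 0 j) f z by exact: fcj.
  apply: filterS => y; rewrite -lerBlDl => H; apply: le_trans H.
  by rewrite distrC lerB_dist.
move=> /nbhs_ballP[r /= r0 rU]; exists (K + 1), r; split=> //.
- by rewrite ltr_wpDl.
- by move=> y /rU[].
move=> v w rv rw.
pose g := fun u : R => v + u *: (w - v).
have gd u : is_derive u 1 g (w - v).
  rewrite /g.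
  have -> : w - v = 0 + (1 *: (w - v)) :> 'rV[R]_n by rewrite add0r scale1r.
  rewrite -[(fun u0 : R => v + _)]/(cst v + (fun u0 : R => u0 *: (0 + 1 *: (w - v)))).
  apply: is_deriveD; rewrite add0r scale1r.
  have dg : differentiable (fun u0 : R => u0 *: (w - v)) u by [].
  apply: DeriveDef; first exact/derivable1_diffP.
  by rewrite deriveE// diff_val scale1r.
have gB u : 0 <= u <= 1 -> ball z r (g u).
  move=> /andP[u0 u1]; move: rv rw; rewrite -!ball_normE /ball_/= /g.
  move=> rv rw.
  have -> : z - (v + u *: (w - v)) = (1 - u) *: (z - v) + u *: (z - w).
    by apply/rowP => j; rewrite !mxE; ring.
  rewrite (le_lt_trans (ler_normD _ _))// !normrZ !ger0_norm ?subr_ge0//.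
  have -> : r = (1 - u) * r + u * r by ring.
  have [->|un0] := eqVneq u 0; first by rewrite subr0 !mul1r !mul0r !addr0.
  by rewrite ler_ltD// ?ler_wpM2l ?subr_ge0 ?(ltW rv)// ltr_pM2l// lt_def un0.
have := @mean_value_rV (f \o g) (fun u => 'd f (g u) (w - v)) (K * `|w - v|) 0 1 ler01.
rewrite subr0 mulr1 /= /g scale0r scale1r addr0 [v + (w - v)]addrC subrK => H.
rewrite distrC [`|v - w|]distrC (@le_trans _ _ (K * `|w - v|))//; last first.
  by rewrite ler_wpM2r// lerDl.
apply: H.
- by rewrite mulr_ge0.
- move=> u u01; have [Ug _] := rU _ (gB u u01).
  by apply: is_derive_comp_diff (gd u) _; exact: fd.
move=> u u01; have [Ug dg] := rU _ (gB u u01).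
rewrite (le_trans (diff_norm_le _ (fd _ Ug)))// ler_wpM2r// ler_sum//.
Unshelve. all: by end_near. Qed.

Lemma mulmx_norm_le v (A : 'M[R]_n) :
  `|v *m A| <= (\sum_i \sum_j `|A i j|) * `|v|.
Proof.
apply: rV_norm_le => [|j].
  by rewrite mulr_ge0// sumr_ge0// => i _; rewrite sumr_ge0.
rewrite mxE (le_trans (ler_norm_sum _ _ _))// mulr_suml ler_sum// => i _.
rewrite normrM mulrC ler_pM// ?rV_coord_le// (bigD1 j)//= lerDl.
exact: sumr_ge0.
Qed.

(** The linear part of [f] at its zero [z] expands lengths by at least
    [1 / k], and the remainder is negligible near [z]. *)
Lemma unit_jacobian_lower_bound (f : 'rV[R]_n -> 'rV[R]_n) z :
  differentiable f z -> f z = 0 -> jacobian f z \in unitmx ->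
  exists2 c, 0 < c & \forall y \near z, c * `|y - z| <= `|f y|.
Proof.
move=> df fz0 Ju; set J := jacobian f z in Ju.
(* [k] bounds the inverse of the differential; the added 1 keeps it positive
   in dimension 0. *)
pose k := \sum_i \sum_j `|invmx J i j| + 1.
have k0 : 0 < k.
  by rewrite ltr_wpDl// sumr_ge0// => i _; rewrite sumr_ge0.
have lb v : k^-1 * `|v| <= `|'d f z v|.
  rewrite ler_pdivrMl//.
  have -> : 'd f z v = v *m J by rewrite /J /jacobian mul_rV_lin1.
  rewrite -[X in `|X| <= _](mulmxK Ju) (le_trans (mulmx_norm_le _ _))//.
  by rewrite ler_wpM2r// lerDl.
have k20 : 0 < k^-1 / 2 by rewrite divr_gt0// invr_gt0.
(* Half of the linear lower bound is spent on the remainder. *)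
exists (k^-1 / 2) => //.
have /eqaddoP/(_ _ k20) := diff_locally df.
rewrite [X in X -> _](near_shift z) sub0r; apply: filterS => y /=.
rewrite -[X in `|X| <= _ -> _]/(f (y - z + z) - (f z + 'd f z (y - z))).
rewrite subrK fz0 add0r => H.
have := lb (y - z); have := ler_distD (f y) ('d f z (y - z)) 0.
rewrite !subr0 distrC; lra.
Qed.
End Calculus.

(** * Charts and flows *)

Lemma diff_cancel (R : realType) (V W : normedModType R)
    (f : V -> W) (g : W -> V) (x v : V) :
  differentiable f x -> differentiable g (f x) ->
  (\forall z \near x, g (f z) = z) -> 'd g (f x) ('d f x v) = v.
Proof.
move=> df dg gf; have dgf := differentiable_comp df dg.
transitivity ('D_v (g \o f) x).
  by rewrite (deriveE _ dgf) (diff_comp df dg).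
by rewrite -[RHS](derive_id x); apply: near_eq_derive.
Qed.

Section Charts.
Variables (R : realType) (n : nat) (M : manifold R n).
Implicit Types (p q x y : M) (i j : Defs.index M) (v w : 'rV[R]_n) (t : R).

Lemma near_dom i p : dom i p -> \forall q \near p, dom i q.
Proof. by move=> ip; apply: open_nbhs_nbhs; split=> //; exact: dom_open. Qed.

Lemma near_chart i p (P : 'rV[R]_n -> Prop) : dom i p ->
  (\forall z \near chart i p, P z) -> \forall q \near p, P (chart i q).
Proof. by move=> ip; apply: chart_continuous. Qed.

Lemma chart_image i p : dom i p -> (chart i @` @dom R n M i) (chart i p).
Proof. by exists p. Qed.

Lemma local_fieldE (X : vector_field M) i p : dom i p ->
  local_field X i (chart i p) = to_chart i p (X p).
Proof. by move=> ip; rewrite /local_field chartK. Qed.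

Lemma transition_differentiable i j p : dom i p -> dom j p ->
  differentiable (chart j \o @unchart R n M i) (chart i p).
Proof.
move=> ip jp; have [/(_ (chart i p)) + _] := @transition_smooth R n M i j 1%N.
by apply; exists p.
Qed.

Lemma near_unchart i p (P : M -> Prop) : dom i p ->
  (\forall q \near p, P q) -> \forall z \near chart i p, P (unchart i z).
Proof.
move=> ip Pp; have := @unchart_continuous R n M i _ (chart_image ip).
by move=> /(_ P); apply; rewrite chartK.
Qed.

Lemma near_chart_image i p : dom i p ->
  \forall z \near chart i p, (chart i @` @dom R n M i) z.
Proof.
move=> ip; apply: open_nbhs_nbhs; split; last exact: chart_image.
exact: chart_image_open.
Qed.

(** Tangent vectors do not depend on the chart used to read them: the two
    transition maps are mutually inverse near the point, hence so are their
    differentials. *)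
Lemma transition_diffK i j p v : dom i p -> dom j p ->
  'd (chart i \o @unchart R n M j) (chart j p)
    ('d (chart j \o @unchart R n M i) (chart i p) v) = v.
Proof.
move=> ip jp; have e : (chart j \o unchart i) (chart i p) = chart j p.
  by rewrite /= chartK.
rewrite -e; apply: diff_cancel.
- exact: transition_differentiable.
- by rewrite e; exact: transition_differentiable.
near=> z; have [q iq qz] : (chart i @` @dom R n M i) z.
  by near: z; exact: near_chart_image.
have : dom j (unchart i z) by near: z; exact: near_unchart (near_dom jp).
by rewrite -qz /= [unchart i _]chartK// => jq; rewrite chartK.
Unshelve. all: by end_near. Qed.

Lemma of_chartK i p v : dom i p -> of_chart i p (to_chart i p v) = v.
Proof. by move=> ip; apply: transition_diffK => //; exact: dom_chart_at. Qed.

Lemma to_chartK i p v : dom i p -> to_chart i p (of_chart i p v) = v.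
Proof. by move=> ip; apply: transition_diffK => //; exact: dom_chart_at. Qed.

Lemma is_derive_change_chart i j (a : R -> M) t v :
  {for t, continuous a} -> dom i (a t) -> dom j (a t) ->
  is_derive t 1 (chart i \o a) v ->
  is_derive t 1 (chart j \o a) ('d (chart j \o unchart i) (chart i (a t)) v).
Proof.
move=> ca ia ja da.
apply: (@near_eq_is_derive _ _ _ ((chart j \o unchart i) \o (chart i \o a))).
  have : \forall s \near t, dom i (a s) by exact: (ca _ (near_dom ia)).
  by apply: filterS => s si /=; rewrite chartK.
by apply: is_derive_comp_diff => //; exact: transition_differentiable.
Qed.

Lemma local_field_continuous (Y : vector_field M) i p : Cr_field 1 Y -> dom i p ->
  {for chart i p, continuous (local_field Y i)}.
Proof.
move=> Y1 ip; apply: differentiable_continuous.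
by have [Yd _] := Y1 i; apply: Yd; exact: chart_image.
Qed.

Lemma chart_field_continuous (Y : vector_field M) i p : Cr_field 1 Y -> dom i p ->
  {for p, continuous (fun q => local_field Y i (chart i q))}.
Proof.
move=> Y1 ip; have c1 := chart_continuous ip.
exact: (continuous_comp c1 (local_field_continuous Y1 ip)).
Qed.

Section Flow.
Variables (X : vector_field M) (phi : R -> M -> M).
Hypothesis phiX : generates X phi.

Lemma flow0 x : phi 0 x = x. Proof. by have [[]] := phiX. Qed.

Lemma flowD s t x : phi (s + t) x = phi s (phi t x).
Proof. by have [[]] := phiX. Qed.

(** Joint continuity of the flow at time zero gives one time interval that
    serves a whole neighbourhood. *)
Lemma flow_near x (P : M -> Prop) : (\forall q \near x, P q) ->
  exists2 d : R, 0 < d &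
    \forall y \near x, forall s, `|s| <= d -> P (phi s y).
Proof.
move=> Px; have [[_ _ cphi] _] := phiX.
have := cphi (0, x) P; rewrite /= flow0 => /(_ Px) [[A B] /= [A0 Bx] AB].
have /nbhs_ballP[e /= e0 eA] := A0; exists (e / 2); first by rewrite divr_gt0.
apply: filterS Bx => y By s sd; apply: (AB (s, y)); split=> //=; apply: eA.
rewrite -ball_normE /ball_/= sub0r normrN; lra.
Qed.

Lemma flow_continuous_time x : continuous (fun t => phi t x).
Proof.
move=> t; have [[_ _ c] _] := phiX.
have cx : {for t, continuous (fun s : R => (s, x))}.
  apply: (@cvg_pair _ _ _ (nbhs t) (nbhs t) (nbhs x) _ _ _ (fun s => s) (fun=> x)).
    exact: cvg_id.
  exact: cvg_cst.
exact: (continuous_comp cx (c (t, x))).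
Qed.

(** The equation of the flow is given in the preferred chart of the moving
    point, which jumps along the orbit; in a fixed chart it becomes an
    autonomous differential equation in coordinate space. *)
Lemma flow_derive i t x : dom i (phi t x) ->
  is_derive t 1 (chart i \o (fun s => phi s x))
    (local_field X i (chart i (phi t x))).
Proof.
move=> ix; rewrite local_fieldE//.
by apply: is_derive_change_chart; [exact: flow_continuous_time|exact: dom_chart_at| |exact: phiX.2].
Qed.

End Flow.
End Charts.

(** * The metric in coordinates *)

Lemma sqrtr_bounds (R : realType) (c C x y : R) : 0 <= c -> 0 <= C -> 0 <= x ->
  c * x ^+ 2 <= y <= C * x ^+ 2 ->
  Num.sqrt c * x <= Num.sqrt y <= Num.sqrt C * x.
Proof.
move=> c0 C0 x0 /andP[cy yC].
have sqE (a : R) : 0 <= a -> Num.sqrt a * x = Num.sqrt (a * x ^+ 2).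
  by move=> a0; rewrite sqrtrM// sqrtr_sqr ger0_norm.
by rewrite !sqE// !ler_wsqrtr.
Qed.

Section Metric.
Variables (R : realType) (n : nat) (M : riemannianManifold R n).
Implicit Types (p q x y : M) (i : Defs.index M) (v w : 'rV[R]_n) (t : R).
Implicit Types (Y Z : vector_field M).

(** The Gram matrix of the coordinate frame of a fixed chart, whose entries,
    unlike those of [metric], vary continuously with the point. *)
Definition gram i z (j k : 'I_n) : R :=
  inner (unchart i z : M) (of_chart i (unchart i z : M) (delta_mx 0 j))
    (of_chart i (unchart i z : M) (delta_mx 0 k)).

Lemma gram_continuous i p j k : dom i p ->
  {for p, continuous (fun q => gram i (chart i q) j k)}.
Proof.
move=> ip; have c1 := chart_continuous ip.
have c2 := @metric_smooth R n M i (delta_mx 0 j) (delta_mx 0 k) 0%N _ (chart_image ip).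
exact: (continuous_comp c1 c2).
Qed.

Lemma inner_of_chart i p v w : dom i p ->
  inner p (of_chart i p v) (of_chart i p w) =
  \sum_j \sum_k v 0 j * w 0 k * gram i (chart i p) j k.
Proof.
move=> ip; rewrite /gram chartK//.
have innerDl u1 u2 u : inner p (u1 + u2) u = inner p u1 u + inner p u2 u.
  by rewrite /inner !mulmxDl mxE.
have innerZl a u1 u : inner p (a *: u1) u = a * inner p u1 u.
  by rewrite /inner -!scalemxAl mxE.
have inner0l u : inner p 0 u = 0 by rewrite /inner !mul0mx mxE.
have suml (a : 'I_n -> 'rV[R]_n) u :
    inner p (\sum_j a j) u = \sum_j inner p (a j) u.
  by elim/big_rec2: _ => [//|j b c _ <-]; rewrite innerDl.
have sumr (a : 'I_n -> 'rV[R]_n) u :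
    inner p u (\sum_j a j) = \sum_j inner p u (a j).
  by rewrite Defs.metric_sym suml; apply: eq_bigr => j _; rewrite Defs.metric_sym.
rewrite [in LHS](row_sum_delta v) [in LHS](row_sum_delta w) /of_chart !linear_sum/=.
rewrite suml; apply: eq_bigr => j _; rewrite sumr; apply: eq_bigr => k _.
by rewrite !linearZ/= innerZl Defs.metric_sym innerZl Defs.metric_sym mulrA.
Qed.

Lemma inner_fields i p Y Z : dom i p ->
  inner p (Y p) (Z p) = \sum_j \sum_k
    local_field Y i (chart i p) 0 j * local_field Z i (chart i p) 0 k *
    gram i (chart i p) j k.
Proof.
move=> ip; rewrite -inner_of_chart// !local_fieldE//.
by rewrite /of_chart -!/(of_chart _ _ _) !of_chartK.
Qed.

Lemma inner_fields_continuous Y Z : Cr_field 1 Y -> Cr_field 1 Z ->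
  continuous (fun p => inner p (Y p) (Z p)).
Proof.
move=> Y1 Z1 p; have ip := dom_chart_at p; set i := chart_at p in ip.
have Yc := chart_field_continuous Y1 ip; have Zc := chart_field_continuous Z1 ip.
have Yj j : {for p, continuous (fun q => local_field Y i (chart i q) 0 j)}.
  exact: (continuous_comp Yc (@coord_continuous _ _ _ 0 j _)).
have Zj j : {for p, continuous (fun q => local_field Z i (chart i q) 0 j)}.
  exact: (continuous_comp Zc (@coord_continuous _ _ _ 0 j _)).
rewrite /prop_for /continuous_at (inner_fields _ _ ip).
have : (\sum_j \sum_k
    local_field Y i (chart i q) 0 j * local_field Z i (chart i q) 0 k *
    gram i (chart i q) j k) @[q --> p] --> \sum_j \sum_k
    local_field Y i (chart i p) 0 j * local_field Z i (chart i p) 0 k *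
    gram i (chart i p) j k.
  apply: cvg_big => [|j _]; first exact: add_continuous.
  apply: cvg_big => [|k _]; first exact: add_continuous.
  by apply: cvgM; [apply: cvgM; [exact: Yj|exact: Zj]|exact: gram_continuous].
apply: cvg_trans; apply: near_eq_cvg.
near=> q; rewrite (@inner_fields i)//; near: q; exact: near_dom.
Unshelve. all: by end_near. Qed.

Lemma tnorm_continuous Y : Cr_field 1 Y -> continuous (fun p => tnorm p (Y p)).
Proof.
move=> Y1 p; rewrite /tnorm; apply: (@continuous_comp _ _ _ (fun p => inner p (Y p) (Y p)) Num.sqrt).
  exact: inner_fields_continuous.
exact: sqrt_continuous.
Qed.

Lemma tnormZ p (a : R) v : tnorm p (a *: v) = `|a| * tnorm p v.
Proof.
rewrite /tnorm /inner linearZ/= -scalemxAr -!scalemxAl scalerA mxE sqrtrM ?sqr_ge0//.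
by rewrite -expr2 sqrtr_sqr.
Qed.

(** At [p] the metric is bounded below on the unit sphere by compactness, and
    the Gram matrix varies little near [p], so that the Riemannian norm and the
    coordinate norm are uniformly equivalent there. *)
Lemma tnorm_chart_bounds i p : dom i p ->
  exists c C : R, [/\ 0 < c, 0 < C & \forall q \near p, forall w,
    c * `|w| <= tnorm q (of_chart i q w) <= C * `|w|].
Proof.
have perturb (a b c t x : R) : - (c / 2 * x) <= a - b -> a - b <= c / 2 * x ->
    b <= t * x -> c * x <= b -> c / 2 * x <= a <= (t + c / 2) * x.
  by move=> *; lra.
move=> ip; pose Q q w := \sum_j \sum_k w 0 j * w 0 k * gram i (chart i q) j k.
have QE q w : dom i q -> tnorm q (of_chart i q w) = Num.sqrt (Q q w).
  by move=> iq; rewrite /tnorm inner_of_chart.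
have [c0 c00 Qp] : exists2 c0 : R, 0 < c0 & forall w, c0 * `|w| ^+ 2 <= Q p w.
  have QZ a w : Q p (a *: w) = a ^+ 2 * Q p w.
    rewrite /Q mulr_sumr; apply: eq_bigr => j _; rewrite mulr_sumr.
    by apply: eq_bigr => k _; rewrite !mxE; ring.
  have Q0 : Q p 0 = 0.
    by rewrite -[X in Q p X](scale0r 0) QZ expr0n mul0r.
  have Qc : continuous (Q p).
    move=> w; have cj j : {for w, continuous (fun v => v 0 j)}.
      exact: coord_continuous.
    apply: (@cvg_big _ _ _ _ _ _ _ (nbhs w)) => [|j _]; first exact: add_continuous.
    apply: (@cvg_big _ _ _ _ _ _ _ (nbhs w)) => [|k _]; first exact: add_continuous.
    apply: (@cvgM _ _ (nbhs w)); last exact: cvg_cst.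
    by apply: (@cvgM _ _ (nbhs w)); exact: cj.
  pose S := [set w : 'rV[R]_n | `|w| = 1].
  (* The sphere is empty in dimension 0. *)
  have [S0|/set0P S0] := eqVneq S set0.
    exists 1 => // w; have [->|w0] := eqVneq w 0.
      by rewrite normr0 expr0n mulr0 Q0.
    have : S (`|w|^-1 *: w).
      by rewrite /S/= normrZ normfV normr_id mulVf// normr_eq0.
    by rewrite S0.
  have Scomp : compact S.
    apply: bounded_closed_compact.
      exists 1; split=> // e e1 w /= ->; exact: ltW.
    rewrite (_ : S = Num.norm @^-1` [set 1 : R]) //.
    apply: closed_comp; last exact: closed_eq.
    by move=> w _; exact: norm_continuous.
  have [w0 w0S w0min] := @EVT_min_rV R n (Q p) S S0 Scomp (continuous_subspaceT Qc).
  have Qw0 : 0 < Q p w0.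
    rewrite /Q -inner_of_chart//; apply: metric_pos; apply/eqP => w00.
    move: w0S; rewrite inE /S/= -(to_chartK w0 ip) w00 /to_chart linear0 normr0.
    by move=> /eqP; rewrite eq_sym oner_eq0.
  exists (Q p w0) => // w; have [->|wn0] := eqVneq w 0.
    by rewrite normr0 expr0n mulr0 Q0.
  have nw : 0 < `|w| by rewrite normr_gt0.
  have /w0min : `|w|^-1 *: w \in S.
    by rewrite inE /S/= normrZ normfV normr_id mulVf// gt_eqF.
  by rewrite QZ exprVn ler_pdivlMl ?exprn_gt0// mulrC.
pose T := \sum_j \sum_k `|gram i (chart i p) j k|.
have T0 : 0 <= T by apply: sumr_ge0 => j _; exact: sumr_ge0.
(* Moving the [n * n] entries by [eta] changes the form by at most half of
   its lower bound. *)
pose eta := c0 / 2 / (n%:R * n%:R + 1).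
have n0 : 0 < n%:R * n%:R + 1 :> R by rewrite ltr_wpDl// mulr_ge0.
have eta0 : 0 < eta by rewrite !divr_gt0.
have QD q w : (forall j k, `|gram i (chart i q) j k - gram i (chart i p) j k| <= eta) ->
    `|Q q w - Q p w| <= c0 / 2 * `|w| ^+ 2.
  move=> qp; rewrite /Q -sumrB (le_trans (ler_norm_sum _ _ _))//.
  apply: (@le_trans _ _ (\sum_(j < n) \sum_(k < n) `|w| ^+ 2 * eta)); last first.
    rewrite !sumr_const !card_ord -mulrnA -[_ *+ (n * n)]mulr_natr natrM.
    rewrite [leLHS]mulrC mulrCA [leRHS]mulrC ler_wpM2l ?exprn_ge0// mulrC.
    have <- : eta * (n%:R * n%:R + 1) = c0 / 2 by rewrite divfK// gt_eqF.
    by rewrite ler_wpM2l ?(ltW eta0)// lerDl.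
  apply: ler_sum => j _; rewrite -sumrB (le_trans (ler_norm_sum _ _ _))//.
  apply: ler_sum => k _; rewrite -mulrBr normrM ler_pM// normrM expr2.
  by rewrite ler_pM// rV_coord_le.
have QT w : Q p w <= T * `|w| ^+ 2.
  rewrite /Q /T mulr_suml ler_sum// => j _; rewrite mulr_suml ler_sum// => k _.
  rewrite (le_trans (ler_norm _))// normrM mulrC ler_wpM2l// normrM expr2.
  by rewrite ler_pM// rV_coord_le.
have c20 : 0 < c0 / 2 by rewrite divr_gt0.
exists (Num.sqrt (c0 / 2)), (Num.sqrt (T + c0 / 2)); split.
- by rewrite sqrtr_gt0.
- by rewrite sqrtr_gt0 ltr_wpDl.
have : \forall q \near p, forall j k,
    `|gram i (chart i q) j k - gram i (chart i p) j k| <= eta.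
  apply: filter_forall => j; apply: filter_forall => k.
  have /cvgrPdist_le/(_ _ eta0) := @gram_continuous i p j k ip.
  by apply: filterS => q Hq; rewrite -normrN opprB; exact: Hq.
move=> Gn; near=> q => w.
have iq : dom i q by near: q; exact: near_dom.
have := QD q w (near Gn q _) => /(_ ltac:(by [])); rewrite ler_norml => /andP[Q1 Q2].
rewrite QE//; apply: sqrtr_bounds => //; first exact: ltW.
  by rewrite addr_ge0// ltW.
exact: perturb Q1 Q2 (QT w) (Qp w).
Unshelve. all: by end_near. Qed.

End Metric.

(** * Uniqueness of flows and behaviour near singularities *)

(** Extends to all times a property of flows that is stable under composition
    and known for small times. *)
Lemma additive_set_full (R : realType) (S : set R) (d : R) : 0 < d ->
  (forall u, `|u| <= d -> S u) -> (forall u v, S u -> S v -> S (u + v)) ->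
  forall u, S u.
Proof.
move=> d0 Sd SD u; pose N := Num.truncn (`|u| / d).
have uN : `|u| / d < N.+1%:R.
  by rewrite truncnS_gt.
have SM k : S ((u / N.+1%:R) *+ k.+1).
  suff S1 : S (u / N.+1%:R).
    by elim: k => [//|k IH]; rewrite mulrSr; exact: SD.
  apply: Sd; rewrite normrM normfV [`|N.+1%:R|]ger0_norm//.
  by rewrite ler_pdivrMr// mulrC -ler_pdivrMr// ltW.
by rewrite -(@divfK _ N.+1%:R _ u) ?pnatr_eq0// mulr_natr.
Qed.

(** A positive constant that can be chosen locally, and decreased at will, can
    be chosen uniformly on a compact set. *)
Lemma compact_uniform (R : realType) (T : topologicalType) (K : set T)
    (P : T -> R -> Prop) : compact K ->
  (forall p, K p -> exists2 d : R, 0 < d &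
     \forall q \near p, forall e, 0 < e <= d -> P q e) ->
  exists2 d : R, 0 < d & forall q, K q -> P q d.
Proof.
move=> /compact_near_coveringP Kc KP.
have := Kc R (0^'+) (fun e q => P q e) _.
case=> [p /KP[d d0 Pd]|e /= e0 He].
  exists ([set q | forall e, 0 < e <= d -> P q e], [set e | 0 < e <= d]) => /=.
    split=> //; near=> e; apply/andP; split; near: e.
      exact: nbhs_right_gt.
    exact: nbhs_right_le.
  by move=> [q e] /= [H1 H2]; exact: H1.
exists (e / 2); first by rewrite divr_gt0.
apply: He; last by rewrite divr_gt0.
rewrite /ball_/= sub0r normrN ger0_norm ?divr_ge0 ?ltW//.
by rewrite ltr_pdivrMr// ltr_pMr// ltr1n.
Unshelve. all: by end_near. Qed.

Section FlowLocal.
Variables (R : realType) (n : nat) (M : manifold R n).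
Implicit Types (p q x y : M) (i : Defs.index M) (v w : 'rV[R]_n) (t : R).

Lemma local_field_eq0 (X : vector_field M) i p : dom i p -> X p = 0 ->
  local_field X i (chart i p) = 0.
Proof. by move=> ip X0; rewrite local_fieldE// X0 /to_chart linear0. Qed.

Lemma fixed_point_singular (X : vector_field M) phi p (d : R) : generates X phi ->
  0 < d -> (forall u, `|u| <= d -> phi u p = p) -> X p = 0.
Proof.
move=> gX d0 fp; have := gX.2 p 0; rewrite (flow0 gX) => -[_ <-].
rewrite -(derive_cst (chart (chart_at p) p) (0 : R) 1); apply: near_eq_derive.
by near=> u; rewrite /= fp//; near: u; apply/nbhs_norm0P; exists d => // u /= /ltW.
Unshelve. all: by end_near. Qed.

Lemma local_field_lipschitz (X : vector_field M) i p : Cr_field 1 X -> dom i p ->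
  exists (K : R) (B : set 'rV[R]_n),
    [/\ 0 < K, \forall q \near p, dom i q /\ B (chart i q) &
      forall v w, B v -> B w ->
        `|local_field X i v - local_field X i w| <= K * `|v - w|].
Proof.
move=> X1 ip.
have [K [r [K0 r0 rU rK]]] := C1_lipschitz (X1 i) (@chart_image_open _ _ M i) (chart_image ip).
exists K, (ball (chart i p) r); split=> //.
near=> q; split; first by near: q; exact: near_dom.
by near: q; apply: (near_chart ip); exact: nbhsx_ballx.
Unshelve. all: by end_near. Qed.

(** In a chart, two flows of the same field issue from the same point and solve
    a Lipschitz equation, so [solutions_stay_close] bounds their distance by
    zero. *)
Lemma flow_unique_near (X : vector_field M) phi phi' p : Cr_field 1 X ->
  generates X phi -> generates X phi' ->
  exists2 d : R, 0 < d & \forall q \near p, forall u, `|u| <= d -> phi u q = phi' u q.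
Proof.
move=> X1 g g'; have ip := dom_chart_at p; set i := chart_at p in ip.
have [K [B [K0 Bp BK]]] := local_field_lipschitz X1 ip.
have d0 : 0 < 1 / 2 / K by rewrite !divr_gt0.
have [d1 d10 near1] := flow_near g Bp; have [d2 d20 near2] := flow_near g' Bp.
(* Up to time [e] both orbits stay in the region where the field is
   [K]-Lipschitz, and [e * K <= 1 / 2]. *)
pose e := Num.min (1 / 2 / K) (Num.min d1 d2).
have [ed ed1 ed2] : [/\ e <= 1 / 2 / K, e <= d1 & e <= d2].
  by split; rewrite /e !ge_min lexx ?orbT.
have e0 : 0 < e by rewrite !lt_min d0 d10 d20.
exists e => //; near=> q => u ue.
have V1 s : `|s| <= e -> dom i (phi s q) /\ B (chart i (phi s q)).
  by move=> se; apply: (near near1 q _); rewrite ?(le_trans se).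
have V2 s : `|s| <= e -> dom i (phi' s q) /\ B (chart i (phi' s q)).
  by move=> se; apply: (near near2 q _); rewrite ?(le_trans se).
have : `|(chart i \o (fun s => phi s q)) u - (chart i \o (fun s => phi' s q)) u|
    <= 2 * `|(chart i \o (fun s => phi s q)) 0 - (chart i \o (fun s => phi' s q)) 0|.
  apply: (solutions_stay_close (ltW e0) _ (ltW K0) BK) ue => [|s se|s se|s se].
  - by rewrite -ler_pdivlMr.
  - by split; [exact: (V1 _ se).2|exact: (V2 _ se).2].
  - by apply: (flow_derive g); exact: (V1 _ se).1.
  - by apply: (flow_derive g'); exact: (V2 _ se).1.
rewrite /= (flow0 g) (flow0 g') subrr normr0 mulr0 normr_le0 subr_eq0 => /eqP eqc.
by rewrite -(chartK (V1 _ ue).1) eqc chartK//; exact: (V2 _ ue).1.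
Unshelve. all: by end_near. Qed.

(** Compactness makes the time of agreement independent of the point; both flows
    then agree at all times by composition. *)
Lemma flow_unique (X : vector_field M) phi phi' : compact [set: M] ->
  Cr_field 1 X -> generates X phi -> generates X phi' ->
  forall u x, phi u x = phi' u x.
Proof.
move=> Mc X1 g g'.
have [|d d0 Hd] := @compact_uniform R M setT
    (fun q d => forall u, `|u| <= d -> phi u q = phi' u q) Mc.
  move=> p _; have [d d0 Hd] := flow_unique_near p X1 g g'; exists d => //.
  by apply: filterS Hd => q Hq e /andP[_ ed] u ue; apply: Hq; exact: le_trans ed.
apply: (additive_set_full d0) => [u ud x|u v Su Sv x]; first exact: Hd.
by rewrite (flowD g) (flowD g') Sv Su.
Qed.

(** The constant curve at a zero [p] is a solution, so [solutions_stay_close]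
    compares every orbit starting near [p] with it; the bound on the field
    follows since it vanishes at [p] and is Lipschitz. *)
Lemma flow_near_zero (Y : vector_field M) psi i p : Cr_field 1 Y ->
  generates Y psi -> dom i p -> Y p = 0 ->
  exists K d : R, [/\ 0 < K, 0 < d & \forall q \near p, forall u, `|u| <= d ->
    [/\ dom i (psi u q),
        `|chart i (psi u q) - chart i p| <= 2 * `|chart i q - chart i p| &
        `|local_field Y i (chart i (psi u q))| <= K * `|chart i q - chart i p| ] ].
Proof.
move=> Y1 g ip Yp.
have [K [B [K0 Bp BK]]] := local_field_lipschitz Y1 ip.
have d0 : 0 < 1 / 2 / K by rewrite !divr_gt0.
have Fp := local_field_eq0 ip Yp.
have Bpp : B (chart i p) by have /= [] := nbhs_singleton Bp.
have [d1 d10 near1] := flow_near g Bp.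
pose e := Num.min (1 / 2 / K) d1.
have [ed ed1] : e <= 1 / 2 / K /\ e <= d1 by split; rewrite /e !ge_min lexx ?orbT.
have e0 : 0 < e by rewrite !lt_min d0 d10.
exists (K * 2), e; split=> //; first by rewrite mulr_gt0.
near=> q => u ue.
have V1 s : `|s| <= e -> dom i (psi s q) /\ B (chart i (psi s q)).
  by move=> se; apply: (near near1 q _); rewrite ?(le_trans se).
have : `|(chart i \o (fun s => psi s q)) u - cst (chart i p) u|
    <= 2 * `|(chart i \o (fun s => psi s q)) 0 - cst (chart i p) (0 : R)|.
  apply: (solutions_stay_close (b := cst (chart i p)) (ltW e0) _ (ltW K0) BK) ue => [|s se|s se|s se].
  - by rewrite -ler_pdivlMr.
  - by split=> //; exact: (V1 _ se).2.
  - by apply: (flow_derive g); exact: (V1 _ se).1.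
  - by rewrite Fp; exact: is_derive_cst.
rewrite /= (flow0 g) => H; split=> //; first exact: (V1 _ ue).1.
have := BK _ _ (V1 _ ue).2 Bpp; rewrite Fp subr0 => /le_trans; apply.
by rewrite -mulrA ler_wpM2l// ltW.
Unshelve. all: by end_near. Qed.

Lemma singular_point_fixed (X : vector_field M) phi p : Cr_field 1 X -> generates X phi ->
  X p = 0 -> forall u, phi u p = p.
Proof.
move=> X1 g Xp; have ip := dom_chart_at p.
have [K [d [K0 d0 /nbhs_singleton Hd]]] := flow_near_zero X1 g ip Xp.
apply: (additive_set_full d0) => [u /Hd[iu + _]|u v Su Sv].
  rewrite subrr normr0 mulr0 normr_le0 subr_eq0 => /eqP eqc.
  by rewrite -(chartK iu) eqc chartK.
by rewrite (flowD g) Sv Su.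
Qed.

(** The eigenvalue zero would have vanishing real part, so the linear part of
    [X] at a hyperbolic singularity is invertible. *)
Lemma hyperbolic_lower_bound (X : vector_field M) p : Cr_field 1 X ->
  hyperbolic X p ->
  exists2 c : R, 0 < c & \forall q \near p,
    c * `|chart (chart_at p) q - chart (chart_at p) p| <=
    `|local_field X (chart_at p) (chart (chart_at p) q)|.
Proof.
move=> X1 [Xp hyp]; have ip := dom_chart_at p; set i := chart_at p in ip hyp *.
have [Xd _] := X1 i; have dX := Xd _ (chart_image ip).
have J : jacobian (local_field X i) (chart i p) \in unitmx.
  rewrite -(map_unitmx (real_complex R)) -row_free_unit -kermx_eq0.
  apply: contraT => ker0; have := hyp 0.
  rewrite /eigenvalue /eigenspace raddf0 subr0 => /(_ ker0).
  by rewrite /= eqxx.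
have [c c0 cX] := unit_jacobian_lower_bound dX (local_field_eq0 ip Xp) J.
by exists c => //; apply: (near_chart ip cX).
Qed.

End FlowLocal.

(** * Distance along an orbit *)

Lemma is_derive_scaled (R : realType) (V : normedModType R) (f : R -> V) (s t : R) (v : V) :
  is_derive (s * t) 1 f v -> is_derive t 1 (fun u => f (s * u)) (s *: v).
Proof.
move=> [/derivable1_diffP df <-].
have gs : is_derive t 1 (fun u : R => s * u) s.
  have -> : s = s *: (1 : R) by rewrite /GRing.scale/= mulr1.
  rewrite (_ : (fun u => _) = s \*: id); first exact: is_deriveZ.
  by apply/funext => u; rewrite /= /GRing.scale/= mulr1.
have := is_derive_comp_diff gs df.
by rewrite deriveE// -[in X in _ *: X](mulr1 1) -linearZ/= /GRing.scale/= !mulr1.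
Qed.

Section RescaledFlow.
Variables (R : realType) (n : nat) (M : manifold R n).
Variables (Y : vector_field M) (psi : R -> M -> M).
Hypothesis gY : generates Y psi.
Implicit Types (s t u : R) (x : M) (i : Defs.index M).

(** Curves entering the distance are parametrized by the unit interval, so the
    orbit segment from [x] to [psi s x] is run through as
    [u |-> psi (s * u) x]. *)
Lemma rescaled_flow_derive i s t x : dom i (psi (s * t) x) ->
  is_derive t 1 (chart i \o (fun u => psi (s * u) x))
    (s *: local_field Y i (chart i (psi (s * t) x))).
Proof. by move=> /(flow_derive gY); exact: is_derive_scaled. Qed.

Lemma rescaled_flow_continuous s x : continuous (fun u => psi (s * u) x).
Proof.
move=> t; have sc : {for t, continuous (fun u : R => s * u)}.
  exact: mulrl_continuous.
apply: (@continuous_comp _ _ _ (fun u => s * u) (psi^~ x)) => //.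
exact: (flow_continuous_time gY).
Qed.

Lemma rescaled_flow_velocity s t x :
  velocity (fun u => psi (s * u) x) t = s *: Y (psi (s * t) x).
Proof. by rewrite /velocity derive1E; have [_ ->] := is_derive_scaled (gY.2 x (s * t)). Qed.

Lemma rescaled_flow_C1 s x : Cr_field 1 Y -> C1_curve (fun u => psi (s * u) x).
Proof.
move=> Y1; split=> [|i t it]; first exact: rescaled_flow_continuous.
have [d _] := rescaled_flow_derive it; split; first exact: d.
set g := fun u => psi (s * u) x; have cg : {for t, continuous g} := @rescaled_flow_continuous s x t.
have gi : \forall u \near t, dom i (g u) by exact: (cg _ (near_dom it)).
have e u : dom i (g u) -> derive1 (chart i \o g) u = s *: local_field Y i (chart i (g u)).
  by move=> iu; rewrite derive1E; have [_ ->] := rescaled_flow_derive iu.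
rewrite /prop_for /continuous_at e//.
have c : {for g t, continuous (fun q => local_field Y i (chart i q))}.
  exact: chart_field_continuous.
have : s *: local_field Y i (chart i (g u)) @[u --> t] --> s *: local_field Y i (chart i (g t)).
  by apply: cvgZr; exact: (continuous_comp cg c).
apply: cvg_trans; apply: near_eq_cvg.
by near=> u; rewrite e//; near: u.
Unshelve. all: by end_near. Qed.

End RescaledFlow.

(** The orbit segment from [x] to [psi s x] is an admissible curve of speed
    [|s| * |Y|], hence of length at most [|s| * C]. *)
Lemma rdist_flow_le (R : realType) (n : nat) (M : riemannianManifold R n)
    (Y : vector_field M) psi (s : R) (x : M) (C : R) : Cr_field 1 Y -> generates Y psi ->
  (forall u, `|u| <= `|s| -> tnorm (psi u x) (Y (psi u x)) <= C) ->
  (rdist x (psi s x) <= (`|s| * C)%:E)%E.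
Proof.
move=> Y1 gY YC; set g := fun u => psi (s * u) x.
have : pw_length (g 0) (g 1) (arc_length g + 0)%E.
  by apply: pw_cons; [exact: (rescaled_flow_C1 gY)|exact: pw_nil].
rewrite /g mulr0 mulr1 (flow0 gY) adde0 => /ereal_inf_lbound/le_trans; apply.
pose h u := `|s| * tnorm (g u) (Y (g u)).
have hE u : tnorm (g u) (velocity g u) = h u.
  by rewrite (rescaled_flow_velocity gY) tnormZ.
rewrite /arc_length; under eq_integral do rewrite hE.
have hc : continuous h.
  move=> u; apply: (@cvgM _ _ (nbhs u)); first exact: cvg_cst.
  have gc : {for u, continuous g} by exact: (rescaled_flow_continuous gY).
  apply: (@continuous_comp _ _ _ g (fun q => tnorm q (Y q))); first exact: gc.
  exact: tnorm_continuous.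
apply: (@le_trans _ _ (\int[lebesgue_measure]_(t in `[0%R, 1%R]) cst (`|s| * C)%:E t)%E).
  apply: ge0_le_integral => //.
  - by move=> u _; rewrite lee_fin mulr_ge0// sqrtr_ge0.
  - apply/measurable_EFinP; apply: measurable_funS (continuous_measurable_fun hc) => //.
  move=> u; rewrite /= in_itv/= => /andP[u0 u1]; rewrite lee_fin ler_wpM2l// YC//.
  by rewrite normrM (ger0_norm u0) ler_piMr.
by rewrite integral_cst//= lebesgue_measure_itv/= lte01 oppr0 adde0 mule1.
Qed.

(** * Approximation on the real line *)

Section RealFunctions.
Variable R : realType.
Implicit Types (f g : R -> R) (a b d e s t : R).

Lemma is_derive0_approx f a e : is_derive (0 : R) 1 f a -> 0 < e ->
  exists2 d, 0 < d & forall s, `|s| < d -> `|f s - f 0 - a * s| <= e * `|s|.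
Proof.
move=> [/derivable1_diffP df <-] e0.
have /eqaddoP/(_ _ e0)/nbhs_norm0P[d /= d0 H] := diff_locally df.
exists d => // s /H; rewrite -[X in `|X| <= _ -> _]/(f (s + 0) - (f 0 + 'd f 0 s)).
rewrite addr0 opprD addrA => /(le_trans _); apply; rewrite deriveE// mulrC.
by rewrite -[s * _]/(s *: _) -linearZ/= /GRing.scale/= mulr1.
Qed.

(** If [f s = g t] with [s] and [t] small, then
    [a * s = b * t + o (|s| + |t|)]; as [b != 0], the error is absorbed into
    [o (|s|)] and [t / s] is close to [a / b]. *)
Lemma ratio_approx f g a b e : is_derive (0 : R) 1 f a -> is_derive (0 : R) 1 g b ->
  b != 0 -> f 0 = g 0 -> 0 < e ->
  exists2 d, 0 < d & forall s t, `|s| < d -> `|t| < d -> f s = g t ->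
    `|t - a / b * s| <= e * `|s|.
Proof.
move=> df dg b0 fg0 e0; have nb : 0 < `|b| by rewrite normr_gt0.
set c := a / b; have c1 : 0 < 1 + `|c| by rewrite ltr_pwDl.
(* [h <= |b| / 2] lets the error term in [|t - c * s|] be absorbed by the
   left-hand side; the second bound turns what remains into [e * |s|]. *)
pose h := Num.min (`|b| / 2) (e * `|b| / 2 / (1 + `|c|)).
have h0 : 0 < h by rewrite lt_min !divr_gt0// mulr_gt0.
have hb : h <= `|b| / 2 by rewrite ge_min lexx.
have he : h * (1 + `|c|) <= e * `|b| / 2.
  by rewrite -ler_pdivlMr// ge_min lexx orbT.
have [d1 d10 H1] := is_derive0_approx df h0.
have [d2 d20 H2] := is_derive0_approx dg h0.
exists (Num.min d1 d2) => [|s t]; first by rewrite lt_min d10.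
rewrite !lt_min => /andP[s1 _] /andP[_ t2] st.
have {}H1 := H1 _ s1; have {}H2 := H2 _ t2.
set r := t - c * s.
have br : `|b| * `|r| <= h * `|s| + h * `|t|.
  have -> : `|b| * `|r| = `|(f s - f 0 - a * s) - (g t - g 0 - b * t)|.
    rewrite -normrM st fg0; congr (`|_|); rewrite /r /c; field.
    by [].
  by rewrite (le_trans (ler_normB _ _))// lerD.
have tr : `|t| <= `|r| + `|c| * `|s|.
  by rewrite -normrM -[X in `|X| <= _](subrK (c * s)) ler_normD.
have ht : h * `|t| <= h * `|r| + h * (`|c| * `|s|).
  by rewrite -mulrDr ler_wpM2l// ltW.
have hr : h * `|r| <= `|b| / 2 * `|r| by rewrite ler_wpM2r.
have hs : h * (1 + `|c|) * `|s| <= e * `|b| / 2 * `|s| by rewrite ler_wpM2r.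
rewrite -(ler_pM2l nb).
by move: ht hr hs br; move: (`|b|) (`|r|) (`|s|) (`|t|) (`|c|) => B X S T D *; nra.
Qed.

(** The multiples of a small vector [(s, t)] of slope close to [A] pass close
    to every point [(r, A * r)] of the line of slope [A]: the multiple
    [m = floor (r / s)] makes [s * m] agree with [r] up to [|s|], and the error
    on the slope is multiplied by [|s * m|] only, which stays bounded. *)
Lemma integer_combination_approx (A r e : R) : 0 < e ->
  exists2 d, 0 < d & exists2 h, 0 < h & forall s t, s != 0 -> `|s| < d ->
    `|t - A * s| <= h * `|s| ->
    exists m : int, `|s *~ m - r| < e /\ `|t *~ m - A * r| < e.
Proof.
move=> e0; have A1 : 0 < `|A| + 1 by rewrite ltr_wpDl.
have r1 : 0 < `|r| + 1 by rewrite ltr_wpDl.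
(* [|s| < 1] gives [|s * m| <= |r| + 1]; the other two bounds control the
   rounding error on each coordinate. *)
pose d := Num.min 1 (Num.min e (e / 2 / (`|A| + 1))).
have d0 : 0 < d by rewrite !lt_min ltr01 e0/= divr_gt0// divr_gt0.
exists d => //; exists (e / 2 / (`|r| + 1)); first by rewrite !divr_gt0.
move=> s t s0; rewrite !lt_min => /and3P[sd1 sde sdA] ts.
have ns : 0 < `|s| by rewrite normr_gt0.
pose m := Num.floor (r / s); exists m.
rewrite -(mulrzr s) -(mulrzr t); set k : R := m%:~R.
have ks : `|s * k - r| <= `|s|.
  have -> : s * k - r = s * (k - r / s) by field.
  rewrite normrM ler_piMr// ler_norml.
  have := floor_le (r / s); have := floorD1_gt (r / s).
  rewrite intrD -/m -/k; move: (r / s) => *; apply/andP; split; lra.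
split; first exact: le_lt_trans sde.
have ms : `|k| * `|s| <= `|r| + 1.
  rewrite -normrM mulrC -[X in `|X| <= _](subrK r) (le_trans (ler_normD _ _))//.
  by rewrite addrC lerD2l (le_trans ks)// ltW.
have -> : t * k - A * r = (t - A * s) * k + A * (s * k - r) by ring.
rewrite (le_lt_trans (ler_normD _ _))// !normrM.
have h1 : `|t - A * s| * `|k| <= e / 2.
  rewrite (@le_trans _ _ (e / 2 / (`|r| + 1) * `|s| * `|k|))//.
    by rewrite ler_wpM2r.
  have -> : e / 2 / (`|r| + 1) * `|s| * `|k| = e / 2 * (`|k| * `|s| / (`|r| + 1)).
    by ring.
  have e20 : 0 <= e / 2 by lra.
  by rewrite ler_piMr// ler_pdivrMr// mul1r.
have h2 : `|A| * `|s * k - r| < e / 2.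
  rewrite (@le_lt_trans _ _ (`|A| * `|s|))// ?ler_wpM2l//.
  rewrite (@le_lt_trans _ _ ((`|A| + 1) * `|s|))// ?ler_wpM2r// ?lerDl//.
  by rewrite mulrC -ltr_pdivlMr.
lra.
Qed.

(** The grid of mesh [d] cuts the plane into countably many cells, whereas the
    graph of [tau] is uncountable: some cell contains two of its points. *)
Lemma close_pair (tau : R -> R) (d : R) : 0 < d ->
  exists s s', [/\ s != s', `|s - s'| < d & `|tau s - tau s'| < d].
Proof.
move=> d0; apply: contrapT => H.
pose cell s := (Num.floor (s / d), Num.floor (tau s / d)).
have close s s' : Num.floor (s / d) = Num.floor (s' / d) -> `|s - s'| < d.
  move=> E; have := floor_le (s / d); have := floorD1_gt (s / d).
  have := floor_le (s' / d); have := floorD1_gt (s' / d); rewrite E.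
  rewrite intrD => h1 h2 h3 h4.
  have : `|s / d - s' / d| < 1 by rewrite ltr_norml; apply/andP; split; lra.
  by rewrite -mulrBl normrM normfV (gtr0_norm d0) ltr_pdivrMr// mul1r.
have cell_inj : injective cell.
  move=> s s' [E1 E2]; apply: contrapT => /eqP ss'; apply: H.
  by exists s, s'; split; [|exact: close|exact: close].
have : countable (`[0, 1]%classic : set R).
  apply/countable_injP; exists (pickle \o cell) => s s' _ _.
  by move=> /(pcan_inj pickleK)/cell_inj.
move=> /countable_lebesgue_measure0/eqP.
by rewrite lebesgue_measure_itv/= lte01 oppr0 adde0 onee_eq0.
Qed.

End RealFunctions.

(** * Reparametrization of an orbit *)

Section Reparametrization.
Variables (R : realType) (n : nat) (M : manifold R n).
Variables (X Y : vector_field M) (phi psi : R -> M -> M) (x : M).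
Hypotheses (gX : generates X phi) (gY : generates Y psi) (Xx : X x != 0).
Implicit Types (s t r : R).

Lemma flow_derive0 (Z : vector_field M) chi j : generates Z chi ->
  is_derive (0 : R) 1 (fun s => chart (chart_at x) (chi s x) 0 j) (Z x 0 j).
Proof.
move=> gZ; have := gZ.2 x 0; rewrite (flow0 gZ) => dZ.
exact: (is_derive_coord j dZ).
Qed.

(** Differentiating the reparametrization at time zero recovers the factor from
    the two fields, which makes it unique where [X] does not vanish. *)
Lemma reparametrization_field (a : R) :
  (forall t, psi t x = phi (a * t) x) -> Y x = a *: X x.
Proof.
move=> psiE; have := gY.2 x 0; rewrite (flow0 gY) => -[_ <-].
rewrite (_ : (fun s => psi s x) = (fun s => phi (a * s) x)); last exact/funext.
have := is_derive_scaled (gX.2 x (a * 0)).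
by rewrite mulr0 (flow0 gX) => -[_ ->].
Qed.

Hypothesis comm : forall s t, psi s (phi t x) = phi t (psi s x).
Hypothesis orb : forall s, Orb phi x (psi s x).

Let H s t := psi s x = phi t x.

Let HD s t s' t' : H s t -> H s' t' -> H (s + s') (t + t').
Proof.
by move=> E E'; rewrite /H (flowD gY) E' comm E -(flowD gX) addrC.
Qed.

Let HN s t : H s t -> H (- s) (- t).
Proof.
move=> E; have xE : x = psi s (phi (- t) x).
  by rewrite comm E -(flowD gX) addNr (flow0 gX).
by rewrite /H {1}xE -(flowD gY) addNr (flow0 gY).
Qed.

Let Hz s t (m : int) : H s t -> H (s *~ m) (t *~ m).
Proof.
move=> E; have Hn k : H (s *+ k) (t *+ k).
  elim: k => [|k IH]; first by rewrite /H !mulr0n (flow0 gX) (flow0 gY).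
  by rewrite !mulrS; exact: HD.
by case: m => k; [exact: Hn|rewrite !NegzE !mulrNz; apply: HN; exact: Hn].
Qed.

(** The set [H] of pairs [(s, t)] with [psi s x = phi t x] is a subgroup of the
    plane. It has small elements with [s != 0] by [close_pair], their slope is
    close to [a] by [ratio_approx], and their multiples approach every
    [(r, a * r)]. As [H] is closed, it contains the whole line of slope [a]. *)
Lemma orbit_reparametrization : exists a : R, forall t, psi t x = phi (a * t) x.
Proof.
have [j Xj] : exists j, X x 0 j != 0.
  apply: contrapT => /forallNP X0; case/negP: Xx; apply/eqP/rowP => j.
  by rewrite mxE; apply/eqP; apply: contrapT => /negP; exact: X0.
pose a := Y x 0 j / X x 0 j; exists a => r.
have small d : 0 < d -> exists s t, [/\ H s t, s != 0, `|s| < d & `|t| < d].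
  move=> d0; have [tau tauE] : {tau : R -> R & forall s, H s (tau s)}.
    by apply: choice => s; have [t _ E] := orb s; exists t.
  have [s [s' [ss' sd td]]] := close_pair tau d0.
  exists (s - s'), (tau s - tau s'); split=> //; last by rewrite subr_eq0.
  by apply: HD => //; exact: HN.
(* Closedness of [H] is the Hausdorff property: any two neighbourhoods of
   [psi r x] and [phi (a * r) x] meet. *)
apply: (@manifold_hausdorff _ _ M) => U V Upsi Vphi.
have near_time (Z : vector_field M) chi t (W : set M) : generates Z chi ->
    nbhs (chi t x) W -> exists2 e : R, 0 < e & forall u, `|u - t| < e -> W (chi u x).
  move=> gZ Wt; have /nbhs_ballP[e /= e0 eW] := flow_continuous_time gZ Wt.
  by exists e => // u ut; apply: eW; rewrite -ball_normE /ball_/= distrC.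
have [e1 e10 U1] := near_time _ _ _ _ gY Upsi.
have [e2 e20 V2] := near_time _ _ _ _ gX Vphi.
have e0 : 0 < Num.min e1 e2 by rewrite lt_min e10.
have [d1 d10 [h h0 Hm]] := integer_combination_approx a r e0.
have [d2 d20 Hr] := ratio_approx (flow_derive0 j gY) (flow_derive0 j gX) Xj
  (congr1 (fun q => chart (chart_at x) q 0 j) (etrans (flow0 gY x) (esym (flow0 gX x)))) h0.
have d0 : 0 < Num.min d1 d2 by rewrite lt_min d10.
have [s [t [Hst s0]]] := small _ d0.
rewrite !lt_min => /andP[s1 s2] /andP[_ t2].
have {}Hr := Hr s t s2 t2 (congr1 (fun q => chart (chart_at x) q 0 j) Hst).
have [m] := Hm s t s0 s1 Hr; rewrite !lt_min => -[/andP[m1 _] /andP[_ m2]].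
exists (psi (s *~ m) x); split; first exact: U1.
by rewrite (Hz m Hst); exact: V2.
Qed.

End Reparametrization.

(** * Domination of one field by the other *)

Section Domination.
Variables (R : realType) (n : nat) (M : riemannianManifold R n).
Variables (X Y : vector_field M) (psi : R -> M -> M).
Hypotheses (X1 : Cr_field 1 X) (Y1 : Cr_field 1 Y) (gY : generates Y psi).
Implicit Types (p q : M).

(** One constant [d] bounds both the time and, as [1 / d], the ratio of the
    norms, so that decreasing [d] preserves the property and a compactness
    argument has a single constant to choose. *)
Definition dominated q (d : R) :=
  forall u, `|u| <= d -> d * tnorm (psi u q) (Y (psi u q)) <= tnorm q (X q).

Lemma dominated_near_regular p : X p != 0 ->
  exists2 d : R, 0 < d &
    \forall q \near p, forall e, 0 < e <= d -> dominated q e.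
Proof.
move=> Xp; pose a := tnorm p (X p) / 2; pose b := tnorm p (Y p) + 1.
have a0 : 0 < a by rewrite divr_gt0// sqrtr_gt0 metric_pos.
have b0 : 0 < b by rewrite ltr_wpDl// sqrtr_ge0.
have Xa : \forall q \near p, a <= tnorm q (X q).
  have /cvgrPdist_le/(_ _ a0) := tnorm_continuous X1 (x := p).
  apply: filterS => q; rewrite ler_norml => /andP[_]; rewrite /a; lra.
have Yb : \forall q \near p, tnorm q (Y q) <= b.
  have /cvgrPdist_le/(_ _ ltr01) := tnorm_continuous Y1 (x := p).
  apply: filterS => q; rewrite ler_norml => /andP[+ _]; rewrite /b; lra.
have [d1 d10 near1] := flow_near gY Yb.
exists (Num.min d1 (a / b)); first by rewrite lt_min d10 divr_gt0.
near=> q => e /andP[e0]; rewrite le_min => /andP[e1 eab] u ue.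
have qa : a <= tnorm q (X q) by near: q.
have qb : tnorm (psi u q) (Y (psi u q)) <= b.
  by apply: (near near1 q _) => //; exact: le_trans e1.
rewrite (le_trans _ qa)// (@le_trans _ _ (e * b))//; last by rewrite -ler_pdivlMr.
by rewrite ler_wpM2l// ltW.
Unshelve. all: by end_near. Qed.

(** In the chart at [p], both fields are compared with the distance to [p]: [X]
    is at least proportional to it by hyperbolicity, and [Y] at most
    proportional to it, even after following its flow for a short time. *)
Lemma dominated_near_singular p : hyperbolic X p -> Y p = 0 ->
  exists2 d : R, 0 < d &
    \forall q \near p, forall e, 0 < e <= d -> dominated q e.
Proof.
move=> hyp Yp; have ip := dom_chart_at p.
have [c c0 Xc] := hyperbolic_lower_bound X1 hyp.
set i := chart_at p in ip Xc *.
have [g [G [g0 G0 Gn]]] := tnorm_chart_bounds ip.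
have [K [d1 [K0 d10 near1]]] := flow_near_zero Y1 gY ip Yp.
have [d2 d20 near2] := flow_near gY Gn.
have normE (Z : vector_field M) q : dom i q ->
    tnorm q (Z q) = tnorm q (of_chart i q (local_field Z i (chart i q))).
  by move=> iq; rewrite local_fieldE// of_chartK.
(* [G * K] and [g * c] are the factors of the upper bound on [Y] and of the
   lower bound on [X] in terms of the distance to [p]. *)
pose d3 := g * c / (G * K).
have d30 : 0 < d3 by rewrite divr_gt0// mulr_gt0.
exists (Num.min d1 (Num.min d2 d3)); first by rewrite !lt_min d10 d20.
near=> q => e /andP[e0]; rewrite !le_min => /and3P[e1 e2 e3] u ue.
have iq : dom i q by near: q; exact: near_dom.
have [iu _ Yu] : [/\ dom i (psi u q),
    `|chart i (psi u q) - chart i p| <= 2 * `|chart i q - chart i p| &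
    `|local_field Y i (chart i (psi u q))| <= K * `|chart i q - chart i p|].
  by apply: (near near1 q _) => //; exact: le_trans e1.
have Yt : tnorm (psi u q) (Y (psi u q)) <= G * (K * `|chart i q - chart i p|).
  rewrite normE//; apply: (@le_trans _ _ (G * `|local_field Y i (chart i (psi u q))|)).
    have := near near2 q _ => /(_ ltac:(by [])) /(_ u (le_trans ue e2)).
    by move=> /(_ (local_field Y i (chart i (psi u q)))) /andP[].
  by rewrite ler_wpM2l// ltW.
have Xt : g * (c * `|chart i q - chart i p|) <= tnorm q (X q).
  rewrite normE//; apply: (@le_trans _ _ (g * `|local_field X i (chart i q)|)).
    by rewrite ler_wpM2l ?(ltW g0)//; near: q.
  have := near Gn q _ => /(_ ltac:(by [])).
  by move=> /(_ (local_field X i (chart i q))) /andP[].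
apply: le_trans Xt; apply: (@le_trans _ _ (d3 * (G * (K * `|chart i q - chart i p|)))).
  by rewrite ler_pM ?sqrtr_ge0// ltW.
by rewrite /d3 !mulrA -[_ * G * K]mulrA divfK// gt_eqF// mulr_gt0.
Unshelve. all: by end_near. Qed.

End Domination.

(** * The centralizer of a rescaling separating flow *)

Unset Implicit Arguments.

Theorem theoremA (R : realType) (n : nat) (M : riemannianManifold R n)
  (M_compact : compact [set: M])
  (X : vector_field M) (X_C1 : Cr_field 1 X)
  (phi : R -> M -> M) (phi_flow : generates X phi)
  (L : set M) (L_compact : compact L) (L_invariant : invariant_set phi L)
  (L_separating : rescaling_separating X phi L)
  (L_hyperbolic : forall p : M, L p -> Sing X p -> hyperbolic X p)
  (Y : vector_field M) (Y_centralizer : centralizer 1 phi L Y)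
  (psi : R -> M -> M) (psi_flow : generates Y psi) :
  exists A : M -> R,
    [/\ {within L `\` Sing X, continuous A},
        forall (x : M) (t : R), (L `\` Sing X) x -> A (phi t x) = A x &
        forall (x : M) (t : R), (L `\` Sing X) x -> psi t x = phi (A x * t) x].
Proof.
have [Y_C1 [psi' [psi'_flow psi'L psi'_comm]]] := Y_centralizer.
have psiE := flow_unique M_compact Y_C1 psi_flow psi'_flow.
have psiL x s : L x -> L (psi s x).
  by move=> Lx; rewrite psiE -(psi'L s); exists x.
have phiL x t : L x -> L (phi t x).
  by move=> Lx; rewrite -(L_invariant t); exists x.
have comm s t x : L x -> psi s (phi t x) = phi t (psi s x).
  by move=> Lx; rewrite !psiE psi'_comm.
(* [psi u p] is a singularity of [X] close to the isolated singularity [p],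
   hence equal to [p]. *)
have Y_sing p : L p -> X p = 0 -> Y p = 0.
  move=> Lp Xp; have ip := dom_chart_at p.
  have [c c0 Xc] := hyperbolic_lower_bound X_C1 (L_hyperbolic _ Lp Xp).
  have isolated : \forall q \near p, dom (chart_at p) q /\
      c * `|chart (chart_at p) q - chart (chart_at p) p| <=
      `|local_field X (chart_at p) (chart (chart_at p) q)|.
    by near=> q; split; near: q => //; exact: near_dom.
  have [d d0 /nbhs_singleton dp] := flow_near psi_flow isolated.
  apply: (fixed_point_singular psi_flow d0) => u ud; have [iu] := dp u ud.
  have Xu : X (psi u p) = 0.
    apply: (fixed_point_singular phi_flow ltr01) => t _.
    by rewrite -comm// (singular_point_fixed X_C1 phi_flow Xp).
  rewrite (local_field_eq0 iu Xu) normr0 pmulr_rle0// normr_le0 subr_eq0.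
  by move=> /eqP eqc; rewrite -(chartK iu) eqc chartK.
have [|d d0 dom_d] := @compact_uniform R M L (dominated X Y psi) L_compact.
  move=> p Lp; have [Xp|Xp] := eqVneq (X p) 0.
    apply: dominated_near_singular => //; first exact: L_hyperbolic.
    exact: Y_sing.
  exact: dominated_near_regular.
(* For [|u| <= eps * d], the segment of [Y] issued from [q = phi t x] has length
   at most [|u| * |X q| / d <= eps * |X q|]. *)
have [eps eps0 sep] := L_separating.
have orb s : forall x, L x -> Orb phi x (psi s x).
  apply: (@additive_set_full R (fun s => forall x, L x -> Orb phi x (psi s x))
    (Num.min d (eps * d))); first by rewrite lt_min d0 mulr_gt0.
    move=> u; rewrite le_min => /andP[ud ued] x Lx.
    apply: sep => // [|t]; first exact: psiL.
    have Lt := phiL x t Lx; set q := phi t x in Lt *.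
    rewrite -comm// -/q.
    apply: (@le_trans _ _ (`|u| * (tnorm q (X q) / d))%:E).
      apply: (rdist_flow_le Y_C1 psi_flow) => v vu.
      by rewrite ler_pdivlMr// mulrC; apply: dom_d => //; exact: le_trans vu ud.
    rewrite lee_fin mulrCA mulrC ler_wpM2r ?sqrtr_ge0//.
    by rewrite ler_pdivrMr.
  move=> u v Su Sv x Lx; rewrite (flowD psi_flow).
  have [t _ <-] := Sv x Lx; have [t' _ <-] := Su _ (phiL x t Lx).
  by exists (t' + t) => //; rewrite (flowD phi_flow).
have reparam x : (L `\` Sing X) x -> exists a : R, forall t, psi t x = phi (a * t) x.
  move=> [Lx /eqP Xx]; apply: (orbit_reparametrization phi_flow psi_flow Xx).
    by move=> s t; exact: comm.
  by move=> s; exact: orb.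
pose A (p : M) := inner p (Y p) (X p) / inner p (X p) (X p).
have AE x a : (L `\` Sing X) x -> (forall t, psi t x = phi (a * t) x) -> A x = a.
  move=> [Lx /eqP Xx] /(reparametrization_field phi_flow psi_flow) YX.
  rewrite /A YX /inner -!scalemxAl mxE mulfK//.
  by rewrite gt_eqF//; exact: metric_pos.
have AP x t : (L `\` Sing X) x -> psi t x = phi (A x * t) x.
  by move=> Lx; have [a aE] := reparam x Lx; rewrite (AE x a).
exists A; split=> //.
  apply: continuous_in_subspaceT => x; rewrite inE => -[_ /eqP Xx].
  apply: (@cvgM _ _ (nbhs x)); first exact: inner_fields_continuous.
  apply: (@cvgV _ _ (nbhs x)); last exact: inner_fields_continuous.
  by rewrite gt_eqF//; exact: metric_pos.
move=> x t Lx; apply: AE => [|s].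
  have [Lx1 Xx] := Lx; split; first exact: phiL.
  move=> Xt; apply: Xx; have := singular_point_fixed X_C1 phi_flow Xt (- t).
  by rewrite -(flowD phi_flow) addNr (flow0 phi_flow) => xE; rewrite /Sing/= xE.
by rewrite comm ?AP//; [rewrite -!(flowD phi_flow) addrC|have [] := Lx].
Unshelve. all: by end_near. Qed.
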